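(* Let $G=(V,E,C)$ be a simple directed edge-labeled graph and let $\mathfrak{n}_G$ be the associated 2-step nilpotent Lie algebra. If $\mathcal{A}(G)=\emptyset$, then $\mathfrak{n}_G$ has no abelian factor. Also, if $\mathcal{A}(G)$ contains only one vertex, then $\mathfrak{n}_G$ has no abelian factor.
   Context: A directed edge-labeled graph $G=(V,E,C)$ is a finite connected directed graph with vertex set $V=\{v_1,\dots,v_n\}$ and edge set $E$, together with a surjective labeling $c:E\to C=\{Z_1,\dots,Z_p\}$, $p\ge 1$ (labels may be repeated on different edges; in particular there is at least one edge). An edge directed from $v$ to $w$ is written $(v,w)$; when direction is irrelevant it is written $vw$. Simple means no loops and at most one edge between any two distinct vertices. The Lie algebra $\mathfrak{n}_G$: as a real vector space $\mathfrak{n}_G=\mathfrak{v}\oplus\mathfrak{w}$, where $\mathfrak{v}$ has basis $V$ and $\mathfrak{w}$ has basis $C$. The bracket is bilinear and skew-symmetric with $[v_i,v_j]=\sum_{\ell}(\epsilon_\ell-\epsilon'_\ell)Z_\ell$, where $\epsilon_\ell=1$ if $c(v_i,v_j)=Z_\ell$ and $0$ otherwise, and $\epsilon'_\ell=1$ if $c(v_j,v_i)=Z_\ell$ and $0$ otherwise; all other brackets of basis elements are zero. The derived algebra is $[\mathfrak{n}_G,\mathfrak{n}_G]=\mathfrak{w}$. The abelian factor of $\mathfrak{n}_G$ is the unique subspace $\mathfrak{a}\subseteq\mathfrak{v}$ such that the center satisfies $\mathcal{Z}(\mathfrak{n}_G)=[\mathfrak{n}_G,\mathfrak{n}_G]\oplus\mathfrak{a}$;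 $\mathfrak{n}_G$ has no abelian factor if $\mathfrak{a}=\{0\}$. For a vertex $v$, $N(v)$ is the set of vertices adjacent to $v$ (ignoring edge direction). For an edge label $Z$, $\deg_Z(v)=|\{w\in N(v): c(vw)=Z\}|$ is the number of edges incident to $v$ with label $Z$. Define $\mathcal{A}(G)=\{v\in V : \text{every } y\in N(v) \text{ has } \deg_{c(vy)}(y)>1\}$. *)

(* Defs.v *)
From HB Require Import structures.
From mathcomp Require Import all_boot all_order all_algebra.

Set Implicit Arguments.
Unset Strict Implicit.
Unset Printing Implicit Defensive.

Import GRing.Theory.
Local Open Scope ring_scope.

(** * Finite-dimensional Lie algebras over a field *)

HB.mixin Record Vector_isLie (F : fieldType) L of Vector F L := {
  lie : L -> L -> L;
  lie_linearl : forall y, linear (lie^~ y);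
  lie_linearr : forall x, linear (lie x);
  liexx : forall x, lie x x = 0;
  lie_jacobi : forall x y z,
    lie x (lie y z) + lie y (lie z x) + lie z (lie x y) = 0
}.

#[short(type="lieAlgType")]
HB.structure Definition LieAlg (F : fieldType) :=
  { L of Vector_isLie F L & Vector F L }.

Section LieAlgebra.
Variables (F : fieldType) (L : lieAlgType F).
Implicit Types (x y : L) (U : {vspace L}).

Lemma lieC x y : lie x y = - lie y x.
Proof.
have lieDl u v z : lie (u + v) z = lie u z + lie v z.
  by have := lie_linearl z 1 u v; rewrite /= !scale1r.
have lieDr u v z : lie z (u + v) = lie z u + lie z v.
  by have := lie_linearr z 1 u v; rewrite /= !scale1r.
have := liexx (x + y); rewrite lieDl !lieDr !liexx add0r addr0.
by move/eqP; rewrite addr_eq0 => /eqP.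
Qed.

Definition ad x : L -> L := lie x.
HB.instance Definition _ x :=
  GRing.isLinear.Build F L L _ (ad x) (@lie_linearr F L x).

Definition adh x : 'End(L) := linfun (ad x).

Lemma adhE x y : adh x y = lie x y. Proof. exact: lfunE. Qed.

Lemma adh_linear : linear adh.
Proof.
move=> a x y; apply/lfunP => z.
by rewrite add_lfunE scale_lfunE !adhE; apply: lie_linearl.
Qed.
HB.instance Definition _ := GRing.isLinear.Build F L 'End(L) _ adh adh_linear.

Definition center : {vspace L} := lker (linfun adh).

Lemma centerP x : reflect (forall y, lie x y = 0) (x \in center).
Proof.
rewrite memv_ker lfunE /=; apply: (iffP eqP) => [x0 y|x0].
  by rewrite -adhE x0 lfunE.
by apply/lfunP => y; rewrite adhE x0 lfunE.
Qed.

Definition derived : {vspace L} :=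
  <<[seq lie x y | x <- vbasis {:L}, y <- vbasis {:L}]>>%VS.

(* [derived] is the smallest subspace containing all brackets. *)
Lemma derived_subP U :
  reflect (forall x y, lie x y \in U) (derived <= U)%VS.
Proof.
apply: (iffP span_subvP) => [sU x y|sU u /allpairsP[[x y] [_ _ ->]] //].
have bx z : z \in <<vbasis {:L}>>%VS.
  by rewrite (span_basis (vbasisP _)) memvf.
have lie_r z u : (forall b, b \in vbasis {:L} -> lie z b \in U) -> lie z u \in U.
  move=> zU; rewrite -adhE (coord_span (bx u)) linear_sum rpred_sum // => j _.
  by rewrite linearZ /= rpredZ // adhE zU // mem_nth ?size_tuple.
apply/lie_r => b bB; rewrite lieC rpredN; apply/lie_r => c cB.
by rewrite lieC rpredN; apply/sU/allpairs_f.
Qed.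

Lemma mem_derived x y : lie x y \in derived.
Proof. by move/derived_subP: (subvv derived). Qed.

End LieAlgebra.

(** * Directed edge-labeled graphs *)

Definition joins (V E : finType) (src dst : E -> V) (e : E) (v w : V) : bool :=
  ((src e == v) && (dst e == w)) || ((src e == w) && (dst e == v)).

Definition adjacent (V E : finType) (src dst : E -> V) : rel V :=
  [rel v w | [exists e, joins src dst e v w]].

Record digraph := Digraph {
  vertex : finType;
  edge : finType;
  label : finType;
  source : edge -> vertex;
  target : edge -> vertex;
  elabel : edge -> label;
  elabel_surj : forall Z, exists e, elabel e = Z;
  label_gt0 : (0 < #|label|)%N;
  (* connected, ignoring the direction of the edges *)
  digraph_connected :
    forall v w, connect (adjacent source target) v w
}.

Definition simple (G : digraph) : Prop :=
  (forall e : edge G, source e != target e) /\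
  (forall e f : edge G,
      [set source e; target e] = [set source f; target f] -> e = f).

Section Graph.
Variable G : digraph.
Implicit Types (v w y : vertex G) (Z : label G) (e : edge G).

Definition nbh v : {set vertex G} :=
  [set w | adjacent (@source G) (@target G) v w].

Definition ldeg Z v : nat :=
  #|[set w in nbh v | 
      [exists e, joins (@source G) (@target G) e v w && (elabel e == Z)]]|.

(* The label c(vy) is that of the edge [e] joining [v] and [y]. *)
Definition Aset : {set vertex G} :=
  [set v | [forall y in nbh v, forall e,
     joins (@source G) (@target G) e v y ==> (1 < ldeg (elabel e) y)%N]].

(* There is an edge directed from [v] to [w] with label [Z]. *)
Definition has_edge v w Z : bool :=
  [exists e, [&& source e == v, target e == w & elabel e == Z]].

End Graph.

(** * The 2-step nilpotent Lie algebra of a graph *)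

(* Pairs of coordinate families: along the vertices, along the labels. *)
Definition nG (F : fieldType) (G : digraph) : Type :=
  ({ffun vertex G -> F^o} * {ffun label G -> F^o})%type.

HB.instance Definition _ F G := Vector.on (nG F G).

Section GraphLie.
Variables (F : fieldType) (G : digraph).
Implicit Types (v w : vertex G) (Z : label G) (x y z : nG F G).

Definition bvertex v : nG F G := ([ffun u => (u == v)%:R], 0).
Definition blabel Z : nG F G := (0, [ffun u => (u == Z)%:R]).

Definition vspan : {vspace nG F G} := <<[seq bvertex v | v : vertex G]>>%VS.
Definition wspan : {vspace nG F G} := <<[seq blabel Z | Z : label G]>>%VS.

(* eps - eps' in the bracket [v, w] *)
Definition struct_coef v w Z : F := (has_edge v w Z)%:R - (has_edge w v Z)%:R.

(* Bilinear extension of [bracket_vv], [bracket_w_l] and [bracket_w_r]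
   below. *)
Definition bracket x y : nG F G :=
  (0, [ffun Z => \sum_v \sum_w x.1 v * y.1 w * struct_coef v w Z]).

Lemma nG_eq x y : x.1 = y.1 -> x.2 = y.2 -> x = y.
Proof. by case: x y => [x1 x2] [y1 y2] /= -> ->. Qed.

Lemma struct_coefC v w Z : struct_coef w v Z = - struct_coef v w Z.
Proof. by rewrite /struct_coef opprB. Qed.

Lemma bracket_linearr x : linear (bracket x).
Proof.
move=> a y z; apply: nG_eq => /=; first by rewrite scaler0 addr0.
apply/ffunP => Z; rewrite !ffunE /= scaler_sumr -big_split; apply: eq_bigr => v _.
rewrite scaler_sumr -big_split; apply: eq_bigr => w _ /=.
have -> : (a *: y.1 + z.1) w = a * y.1 w + z.1 w by rewrite !ffunE.
have -> (u : F^o) : a *: u = a * u by [].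
by rewrite [x.1 v * (_ + _)]mulrDr mulrDl -!mulrA [x.1 v * (a * _)]mulrCA.
Qed.

Lemma bracketC x y : bracket x y = - bracket y x.
Proof.
apply: nG_eq => /=; first by rewrite oppr0.
apply/ffunP => Z; rewrite !ffunE /= exchange_big -sumrN; apply: eq_bigr => v _.
rewrite -sumrN; apply: eq_bigr => w _.
by rewrite (struct_coefC v w) mulrN [x.1 w * _]mulrC.
Qed.

Lemma bracket_linearl y : linear (bracket^~ y).
Proof.
move=> a x z; rewrite bracketC bracket_linearr.
by rewrite (bracketC x) (bracketC z) scalerN opprD.
Qed.

Lemma bracketxx x : bracket x x = 0.
Proof.
apply: nG_eq => //=; apply/ffunP => Z; rewrite !ffunE /=.
(* in any characteristic: split the double sum into v < w and w < v *)
pose f v w := x.1 v * x.1 w * struct_coef v w Z.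
have fC v w : f w v = - f v w.
  by rewrite /f struct_coefC mulrN [x.1 w * _]mulrC.
have fvv v : f v v = 0 by rewrite /f /struct_coef subrr mulr0.
rewrite -[LHS]/(\sum_v \sum_w f v w).
pose lt v w := (enum_rank v < enum_rank w)%N.
have -> : \sum_v \sum_w f v w =
    \sum_v \sum_(w | lt v w) f v w + \sum_v \sum_(w | lt w v) f v w.
  rewrite -big_split; apply: eq_bigr => v _ /=.
  rewrite (bigID (lt v)) /=; congr (_ + _).
  rewrite [LHS](bigID (pred1 v)) /= [X in X + _]big1 ?add0r; last first.
    by move=> w /andP[_ /eqP->].
  apply: eq_bigl => w; rewrite /lt -leqNgt [RHS]ltn_neqAle andbC.
  by rewrite (inj_eq val_inj) (inj_eq enum_rank_inj).
rewrite [X in _ + X](exchange_big_dep predT) //= -big_split big1 // => v _ /=.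
rewrite -big_split big1 // => w _ /=.
by rewrite [f w v]fC subrr.
Qed.

Lemma bracket_w_r x y : y.1 = 0 -> bracket x y = 0.
Proof.
move=> y0; apply: nG_eq => //=; apply/ffunP => Z; rewrite !ffunE /= big1 // => v _.
by rewrite big1 // => w _; rewrite y0 ffunE mulr0 mul0r.
Qed.

Lemma bracket_w_l x y : x.1 = 0 -> bracket x y = 0.
Proof. by move=> x0; rewrite bracketC bracket_w_r ?oppr0. Qed.

Lemma bracket_jacobi x y z :
  bracket x (bracket y z) + bracket y (bracket z x)
    + bracket z (bracket x y) = 0.
Proof. by rewrite !(@bracket_w_r _ (bracket _ _)) // !addr0. Qed.

HB.instance Definition _ := Vector_isLie.Build F (nG F G)
  bracket_linearl bracket_linearr bracketxx bracket_jacobi.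

Lemma sum_vertexE (f : {ffun vertex G -> F^o}) :
  (f, 0) = \sum_v f v *: bvertex v :> nG F G.
Proof.
apply: nG_eq; rewrite /= ?(raddf_sum fst) ?(raddf_sum snd) /=.
  apply/ffunP => u; rewrite sum_ffunE (bigD1 u) //= !ffunE eqxx.
  rewrite big1 => [|v vu]; first by rewrite addr0 -[RHS]/(_ * _) mulr1.
  by rewrite !ffunE eq_sym (negPf vu) scaler0.
by rewrite big1 // => v _; rewrite scaler0.
Qed.

Lemma sum_labelE (f : {ffun label G -> F^o}) :
  (0, f) = \sum_Z f Z *: blabel Z :> nG F G.
Proof.
apply: nG_eq; rewrite /= ?(raddf_sum fst) ?(raddf_sum snd) /=.
  by rewrite big1 // => v _; rewrite scaler0.
apply/ffunP => u; rewrite sum_ffunE (bigD1 u) //= !ffunE eqxx.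
rewrite big1 => [|v vu]; first by rewrite addr0 -[RHS]/(_ * _) mulr1.
by rewrite !ffunE eq_sym (negPf vu) scaler0.
Qed.

(* The defining formula of the bracket on pairs of vertices. *)
Lemma bracket_vv v w :
  lie (bvertex v) (bvertex w) = \sum_Z struct_coef v w Z *: blabel Z.
Proof.
have -> : \sum_Z struct_coef v w Z *: blabel Z
    = (0, [ffun Z => struct_coef v w Z]) :> nG F G.
  by rewrite sum_labelE; apply: eq_bigr => Z _; rewrite ffunE.
apply: nG_eq => //=; apply/ffunP => Z; rewrite !ffunE (bigD1 v) //= (bigD1 w) //=.
rewrite !ffunE !eqxx !mul1r !big1 ?addr0 // => [u uv|u uw].
  by rewrite big1 // => t _; rewrite !ffunE (negPf uv) !mul0r.
by rewrite !ffunE (negPf uw) mulr0 mul0r.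
Qed.

Lemma mem_vspan x : (x \in vspan) = (x.2 == 0).
Proof.
apply/idP/eqP => [/coord_span->|x0].
  rewrite (raddf_sum snd) big1 // => i _ /=.
  have : ([seq bvertex v | v : vertex G])`_i \in [seq bvertex v | v : vertex G].
    by apply: mem_nth; rewrite size_map -cardE.
  by case/mapP => v _ ->; rewrite scaler0.
have -> : x = (x.1, 0) by case: x x0 => ? ? /= ->.
rewrite sum_vertexE rpred_sum // => v _; rewrite rpredZ // memv_span //.
by apply: map_f; rewrite mem_enum.
Qed.

Lemma mem_wspan x : (x \in wspan) = (x.1 == 0).
Proof.
apply/idP/eqP => [/coord_span->|x0].
  rewrite (raddf_sum fst) big1 // => i _ /=.
  have : ([seq blabel v | v : label G])`_i \in [seq blabel v | v : label G].
    by apply: mem_nth; rewrite size_map -cardE.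
  by case/mapP => v _ ->; rewrite scaler0.
have -> : x = (0, x.2) by case: x x0 => ? ? /= ->.
rewrite sum_labelE rpred_sum // => v _; rewrite rpredZ // memv_span //.
by apply: map_f; rewrite mem_enum.
Qed.

Lemma vwspan_direct : (vspan + wspan = fullv)%VS /\ (vspan :&: wspan = 0)%VS.
Proof.
split; apply/eqP.
  rewrite eqEsubv subvf; apply/subvP => x _; apply/memv_addP.
  exists (x.1, 0); first by rewrite mem_vspan.
  exists (0, x.2); first by rewrite mem_wspan.
  by apply: nG_eq; rewrite /= ?addr0 ?add0r.
rewrite -subv0; apply/subvP => x.
rewrite memv_cap mem_vspan mem_wspan memv0 => /andP[/eqP x2 /eqP x1].
by apply/eqP/nG_eq.
Qed.

Lemma derived_wspan : simple G -> derived (nG F G) = wspan.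
Proof.
move=> [noloop nomulti]; apply/eqP; rewrite eqEsubv; apply/andP; split.
  by apply/derived_subP => x y; rewrite mem_wspan.
apply/span_subvP => _ /mapP[Z _ ->]; have [e <-] := elabel_surj Z.
suff <- : lie (bvertex (source e)) (bvertex (target e)) = blabel (elabel e).
  exact: mem_derived.
rewrite bracket_vv (bigD1 (elabel e)) //= big1 => [|Z' Z'e].
  rewrite addr0 /struct_coef.
  have -> : has_edge (source e) (target e) (elabel e).
    by apply/existsP; exists e; rewrite !eqxx.
  have /negPf -> : ~~ has_edge (target e) (source e) (elabel e).
    apply/existsP => -[f /and3P[/eqP sf /eqP tf _]].
    have ef : e = f by apply: nomulti; rewrite sf tf setUC.
    by have := noloop e; rewrite {1}ef sf eqxx.
  by rewrite subr0 scale1r.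
rewrite /struct_coef.
have /negPf -> : ~~ has_edge (source e) (target e) Z'.
  apply/existsP => -[f /and3P[/eqP sf /eqP tf /eqP lf]].
  have ef : e = f by apply: nomulti; rewrite sf tf.
  by rewrite -lf ef eqxx in Z'e.
have /negPf -> : ~~ has_edge (target e) (source e) Z'.
  apply/existsP => -[f /and3P[/eqP sf /eqP tf /eqP lf]].
  have ef : e = f by apply: nomulti; rewrite sf tf setUC.
  by rewrite -lf ef eqxx in Z'e.
by rewrite subrr scale0r.
Qed.

Definition is_abelian_factor (a : {vspace nG F G}) : bool :=
  [&& (a <= vspan)%VS,
      center (nG F G) == (derived (nG F G) + a)%VS &
      directv (derived (nG F G) + a)].

Lemma abelian_factor_ex : simple G -> exists a, is_abelian_factor a.
Proof.
move=> sG; exists (center (nG F G) :&: vspan)%VS.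
have [_ vw0] := vwspan_direct.
rewrite /is_abelian_factor derived_wspan // capvSr /=; apply/andP; split.
  have wZ : (wspan <= center (nG F G))%VS.
    apply/subvP => x; rewrite mem_wspan => /eqP x1; apply/centerP => y.
    exact: bracket_w_l.
  rewrite eqEsubv subv_add wZ capvSl !andbT; apply/subvP => x xZ.
  have w2 : (0, x.2) \in wspan by rewrite mem_wspan.
  apply/memv_addP; exists (0, x.2) => //; exists (x - (0, x.2)).
    rewrite memv_cap; apply/andP; split; first by rewrite rpredB // (subvP wZ).
    by rewrite mem_vspan; apply/eqP/subrr.
  by rewrite addrC subrK.
apply/directv_addP/eqP; rewrite -subv0 -vw0; apply/subvP => x.
by rewrite !memv_cap => /and3P[-> _ ->].
Qed.

Lemma abelian_factor_uniq a b :
  simple G -> is_abelian_factor a -> is_abelian_factor b -> a = b.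
Proof.
move=> sG; have [_ vw0] := vwspan_direct.
wlog suff sub : a b / is_abelian_factor a -> is_abelian_factor b -> (a <= b)%VS.
  by move=> fa fb; apply/eqP; rewrite eqEsubv !sub.
move=> /and3P[av /eqP Za _] /and3P[bv /eqP Zb _].
apply/subvP => x xa; have : x \in center (nG F G).
  by rewrite Za (subvP (addvSr _ _)).
rewrite Zb derived_wspan // => /memv_addP[w ww [y yb xE]].
suff w0 : w = 0 by rewrite xE w0 add0r.
apply/eqP; rewrite -memv0 -vw0 memv_cap ww andbT.
have -> : w = x - y by rewrite xE addrK.
by apply: rpredB; [apply: (subvP av) | apply: (subvP bv)].
Qed.

(* The unique subspace given by [abelian_factor_ex] and
   [abelian_factor_uniq]. *)
Definition abelian_factor (sG : simple G) : {vspace nG F G} :=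
  xchoose (abelian_factor_ex sG).

Lemma abelian_factorP (sG : simple G) : is_abelian_factor (abelian_factor sG).
Proof. exact: xchooseP. Qed.

Definition no_abelian_factor (sG : simple G) : Prop := abelian_factor sG = 0%VS.

End GraphLie.

(* Main.v *)
Require Import Defs.
From mathcomp Require Import all_boot all_order all_algebra.
From mathcomp Require Import reals.

Set Implicit Arguments.
Unset Strict Implicit.
Unset Printing Implicit Defensive.

Import GRing.Theory.
Local Open Scope ring_scope.

(** The abelian factor consists of the central elements [x] of the span of the
    vertices, so the claim is that such an [x] vanishes.  Bracketing [x] with a
    vertex [y] and reading the coordinate along a label [Z] gives a signed sum
    of the coordinates of [x] at the neighbours of [y] along edges labelled [Z].
    When at most one of these coordinates can be nonzero, centrality forces it
    to vanish ([central_coord_eq0]).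

    If [v] lies outside [Aset G], some neighbour [y] of [v] has exactly one
    incident edge with the label of [vy], so the sum has a single term and [x]
    has no coordinate at [v] ([central_coord_notin_Aset]).  This settles the
    case where [Aset G] is empty.  If [Aset G] is reduced to [v], then [x] is a
    multiple of [v]; as [G] is connected and has an edge that is not a loop, [v]
    has a neighbour [y] ([exists_incident_edge]), and in the bracket of [x] with
    [y] only the term at [v] can be nonzero, so [x] vanishes again. *)

Section AbelianFactor.
Variables (F : fieldType) (G : digraph) (sG : simple G).
Implicit Types (v w y : vertex G) (e f : edge G) (Z : label G) (x : nG F G).

Local Notation joins := (joins (@source G) (@target G)).

Lemma struct_coef_neq0P v w Z :
  struct_coef F v w Z != 0 -> exists2 e, joins e v w & elabel e == Z.
Proof.
rewrite /struct_coef; case vw: (has_edge v w Z).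
  move=> _; case/existsP: vw => e /and3P[sv tw lZ].
  by exists e; rewrite // /Defs.joins sv tw.
case wv: (has_edge w v Z); last by rewrite subrr eqxx.
move=> _; case/existsP: wv => e /and3P[sw tv lZ].
by exists e; rewrite // /Defs.joins sw tv orbT.
Qed.

(** Simplicity excludes an edge in the opposite direction, which could carry
    the same label and cancel the contribution of [e]. *)
Lemma struct_coef_joins e v w : joins e v w -> struct_coef F v w (elabel e) != 0.
Proof.
case: sG => noloop nomulti.
have coef_e : struct_coef F (source e) (target e) (elabel e) = 1.
  rewrite /struct_coef.
  have -> : has_edge (source e) (target e) (elabel e).
    by apply/existsP; exists e; rewrite !eqxx.
  have /negPf -> : ~~ has_edge (target e) (source e) (elabel e).
    apply/existsP => -[f /and3P[/eqP sf /eqP tf _]].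
    have ef : e = f by apply: nomulti; rewrite sf tf setUC.
    by have := noloop e; rewrite {1}ef sf eqxx.
  by rewrite subr0.
case/orP => /andP[/eqP<- /eqP<-]; last rewrite struct_coefC oppr_eq0.
  by rewrite coef_e oner_eq0.
by rewrite coef_e oner_eq0.
Qed.

Lemma lie_bvertexE x y Z :
  (lie x (bvertex F y)).2 Z = \sum_w x.1 w * struct_coef F w y Z.
Proof.
rewrite /= ffunE; apply: eq_bigr => w _.
rewrite (bigD1 y) //= big1 => [|u uy].
  by rewrite ffunE eqxx mulr1 addr0.
by rewrite ffunE (negPf uy) mulr0 mul0r.
Qed.

(** In the coordinate of the bracket with [y] along the label of [e], the
    structure coefficients discard the edges with another label, and the
    hypothesis discards those with the same label; only the term at [v] is left,
    with an invertible coefficient.  The hypothesis bears on the coordinates of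
    [x] rather than on the edges, so that it can be met either because [y] has a
    single edge with this label or because [x] is already known elsewhere. *)
Lemma central_coord_eq0 x e v y :
    x \in center (nG F G) -> joins e v y ->
    (forall w f, w != v -> joins f w y -> elabel f = elabel e -> x.1 w = 0) ->
  x.1 v = 0.
Proof.
move=> /centerP/(_ (bvertex F y)) xy0 evy other0.
have := lie_bvertexE x y (elabel e); rewrite xy0 ffunE (bigD1 v) //= big1.
  rewrite addr0 => /esym/eqP.
  by rewrite mulf_eq0 (negPf (struct_coef_joins evy)) orbF => /eqP.
move=> w wv; apply/eqP; rewrite mulf_eq0.
have [//|/struct_coef_neq0P[f fwy /eqP fe]] := eqVneq (struct_coef F w y _) 0.
  by rewrite orbT.
by rewrite (other0 _ _ wv fwy fe) eqxx.
Qed.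

Lemma ldeg_le1_uniq e f v w y : (ldeg (elabel e) y <= 1)%N ->
  joins e v y -> joins f w y -> elabel f = elabel e -> w = v.
Proof.
have joinsC g u t : joins g u t = joins g t u by rewrite /Defs.joins orbC.
move=> /card_le1_eqP deg1 evy fwy fe.
apply: deg1; rewrite !inE; apply/andP; split; apply/existsP.
- by exists e; rewrite joinsC.
- by exists e; rewrite joinsC evy eqxx.
- by exists f; rewrite joinsC.
- by exists f; rewrite joinsC fwy fe eqxx.
Qed.

Lemma central_coord_notin_Aset x v :
  x \in center (nG F G) -> v \notin Aset G -> x.1 v = 0.
Proof.
move=> xZ; rewrite inE => /forall_inPn[y _ /forallPn[e]].
rewrite negb_imply -leqNgt => /andP[evy deg1].
apply: (central_coord_eq0 _ evy) => // w f wv fwy fe.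
by rewrite (ldeg_le1_uniq deg1 evy fwy fe) eqxx in wv.
Qed.

(** A label exists and labels some edge; one of its two distinct ends differs
    from [v], and a path from [v] to that end starts with an edge at [v]. *)
Lemma exists_incident_edge v : exists e y, joins e v y.
Proof.
have [Z _] : exists Z : label G, Z \in predT by apply/card_gt0P/label_gt0.
have [e _] := elabel_surj Z; have [noloop _] := sG.
have [w wv] : exists w, w != v.
  have [sv|] := eqVneq (source e) v; last by exists (source e).
  by exists (target e); rewrite eq_sym -sv noloop.
have /connectP[[|y p] /= vp wE] := digraph_connected v w.
  by rewrite wE eqxx in wv.
by case/andP: vp => /existsP[f fvy] _; exists f, y.
Qed.

Lemma central_coord_Aset1 x v :
  x \in center (nG F G) -> Aset G = [set v] -> x.1 = 0.
Proof.
move=> xZ Av.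
have x0 w : w != v -> x.1 w = 0.
  by move=> wv; apply: central_coord_notin_Aset; rewrite // Av inE.
apply/ffunP => w; rewrite ffunE; have [->|/x0//] := eqVneq w v.
have [e [y evy]] := exists_incident_edge v.
by apply: (central_coord_eq0 xZ evy) => u f /x0.
Qed.

Lemma no_abelian_factor_of_center :
  (forall x, x \in center (nG F G) -> x.1 = 0) -> no_abelian_factor F sG.
Proof.
move=> Z0; have /and3P[av /eqP ZE _] := abelian_factorP F sG.
apply/eqP; rewrite -subv0; apply/subvP => x xa.
have x2 : x.2 = 0 by apply/eqP; rewrite -mem_vspan (subvP av).
rewrite memv0; apply/eqP/nG_eq => //=.
by apply: Z0; rewrite ZE (subvP (addvSr _ _)).
Qed.

End AbelianFactor.

Theorem corollary2p15 (R : realType) (G : digraph) (sG : simple G) :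
  (Aset G = set0 -> no_abelian_factor R sG) /\
  (#|Aset G| = 1%N -> no_abelian_factor R sG).
Proof.
split=> [A0 | /eqP/cards1P[v Av]]; apply: no_abelian_factor_of_center => x xZ.
  apply/ffunP => v; rewrite ffunE.
  by apply: central_coord_notin_Aset; rewrite // A0 inE.
exact: central_coord_Aset1 xZ Av.
Qed.
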